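(* Let $p$ be an odd prime and let $G$ be a GGS-group over the $p$-adic tree with non-constant defining vector. Then $$\psi(\gamma_3(\mathrm{Stab}_G(1)))=\gamma_3(G)\times\overset{p}{\cdots}\times\gamma_3(G).$$ In particular, $$\gamma_3(G)\times\overset{p}{\cdots}\times\gamma_3(G)\subseteq\psi(\gamma_3(G)),$$ and $G$ is a regular branch group over $\gamma_3(G)$.
   Context: Let $p$ be an odd prime and $X=\{1,\ldots,p\}$. The $p$-adic tree $\mathcal{T}$ is the rooted tree whose vertex set is the free monoid $X^*$, where the words $vx$ ($x\in X$) are the immediate descendants of $v$. In $\mathrm{Aut}\,\mathcal{T}$, the product $fg$ means first $f$, then $g$. $\mathrm{Stab}(n)$ is the subgroup of automorphisms fixing all words of length $n$, and $\mathrm{Stab}_G(n)=\mathrm{Stab}(n)\cap G$ for $G\le\mathrm{Aut}\,\mathcal{T}$. The isomorphism $\psi:\mathrm{Stab}(1)\to \mathrm{Aut}\,\mathcal{T}\times\cdots\times\mathrm{Aut}\,\mathcal{T}$ ($p$ factors) sends $g$ to $(g_1,\ldots,g_p)$, where $g_i$ is the automorphism of $\mathcal{T}$ induced by restricting $g$ to the subtree hanging from the vertex $i$. $\gamma_i(G)$ denotes the $i$th term of the lower central series. Let $a$ be the rooted automorphism permuting rigidly the $p$ subtrees hanging from the root according to the cycle $(1\ 2\ \ldots\ p)$; $a$ has order $p$, so $a^k$ makes sense for $k\in\mathbb{F}_p$. Given a non-zero vector $\mathbf{e}=(e_1,\ldots,e_{p-1})\in\mathbb{F}_p^{p-1}$,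 let $b$ be defined recursively by $\psi(b)=(a^{e_1},\ldots,a^{e_{p-1}},b)$. The group $G=\langle a,b\rangle$ is the GGS-group with defining vector $\mathbf{e}$. The vector $\mathbf{e}$ is constant if $e_1=\cdots=e_{p-1}$. Let $G$ be a self-similar (all automorphisms induced by elements of $G$ on subtrees hanging from vertices belong to $G$) spherically transitive (transitive on every level) group of automorphisms of a regular tree, and let $K$ be a non-trivial subgroup of $\mathrm{Stab}_G(1)$. $G$ is weakly regular branch over $K$ if $K\times\cdots\times K\subseteq\psi(K)$; if furthermore $K$ has finite index in $G$, then $G$ is regular branch over $K$. Every GGS-group is self-similar and spherically transitive. *)

(* Defs.v *)
From HB Require Import structures.
From mathcomp Require Import all_boot all_algebra.
From mathcomp Require Import all_classical.

Set Implicit Arguments.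
Unset Strict Implicit.
Unset Printing Implicit Defensive.

Local Open Scope classical_set_scope.
Local Open Scope group_scope.

(* Subgroups of a possibly infinite group are encoded as classical sets. *)
Section Subgroups.
Variable gT : groupType.
Implicit Types A B H K : set gT.

Definition is_subgroup H : Prop :=
  [/\ H 1, (forall x y, H x -> H y -> H (x * y))
         & (forall x, H x -> H x^-1)].

Definition generated A : set gT := smallest is_subgroup A.

Definition commutator_subgroup A B : set gT :=
  generated [set z | exists x y, [/\ A x, B y & z = [~ x, y]]].

Fixpoint gamma_rec n H : set gT :=
  if n is m.+1 then commutator_subgroup (gamma_rec m H) H else H.

(* Indexed from 1: gamma 1 H = H and
   gamma n.+2 H = commutator_subgroup (gamma n.+1 H) H. *)
Definition gamma n H : set gT := gamma_rec n.-1 H.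

Definition finite_index K H : Prop :=
  finite_set [set [set k * h | k in K] | h in H].

End Subgroups.

(* The vertices of the tree are the words over 'I_p, so the letter i of
   {1, ..., p} is represented by i - 1. *)
Section TreeAut.
Variable p : nat.
Local Notation word := (seq 'I_p).
Implicit Types u v w : word.

Definition child v w : Prop := exists x, w = rcons v x.

Definition is_tree_aut (f : word -> word) : Prop :=
  [/\ bijective f, f [::] = [::]
    & forall v w, child v w <-> child (f v) (f w)].

Record tree_aut := TreeAut {
  tree_fun :> word -> word;
  tree_autP : is_tree_aut tree_fun }.

Lemma tree_aut_ext (f g : tree_aut) : f =1 g -> f = g.
Proof.
case: f g => [f fP] [g gP] /= /funext fg; rewrite -fg in gP *.
by rewrite (Prop_irrelevance fP gP).
Qed.

Lemma child_cat u v w : child (u ++ v) (u ++ w) <-> child v w.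
Proof.
split=> [[x]|[x ->]]; last by exists x; rewrite rcons_cat.
by rewrite rcons_cat => /eqP; rewrite eqseq_cat // => /andP[_ /eqP ->]; exists x.
Qed.

Lemma is_tree_aut_size f w : is_tree_aut f -> size (f w) = size w.
Proof.
move=> [_ f0 fc]; elim/last_ind: w => [|w x IHw]; first by rewrite f0.
have [|y ->] := (fc w (rcons w x)).1; first by exists x.
by rewrite !size_rcons IHw.
Qed.

Lemma is_tree_aut_cat f u w : is_tree_aut f ->
  f (u ++ w) = f u ++ drop (size u) (f (u ++ w)).
Proof.
move=> fP; have [_ f0 fc] := fP; elim/last_ind: w => [|w x IHw].
  by rewrite cats0 drop_oversize ?cats0 // is_tree_aut_size.
have [|y fE] := (fc (u ++ w) (u ++ rcons w x)).1.
  by exists x; rewrite rcons_cat.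
rewrite fE IHw rcons_cat; congr cat.
rewrite -(is_tree_aut_size u fP) drop_size_cat //.
Qed.

Lemma mk_is_tree_aut f g : cancel f g -> cancel g f -> f [::] = [::] ->
  (forall v x, child (f v) (f (rcons v x))) -> is_tree_aut f.
Proof.
move=> fK gK f0 fc; split=> //; first by exists g.
move=> v w; split=> [[x ->]//|].
case/lastP: w => [|w x].
  by rewrite f0 => -[y]; case: (f v).
have [y ->] := fc w x => -[z] /rcons_inj[/(can_inj fK) -> _].
by exists x.
Qed.

Lemma is_tree_aut_id : is_tree_aut id.
Proof. by split=> //; exists id. Qed.

Lemma is_tree_aut_comp f g :
  is_tree_aut f -> is_tree_aut g -> is_tree_aut (g \o f).
Proof.
move=> [fb f0 fc] [gb g0 gc]; split=> /=; first exact: bij_comp.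
  by rewrite f0.
by move=> v w; rewrite fc gc.
Qed.

Lemma is_tree_aut_can f g :
  is_tree_aut f -> cancel f g -> cancel g f -> is_tree_aut g.
Proof.
move=> [fb f0 fc] fK gK; split; first by exists f.
  by rewrite -f0 fK.
by move=> v w; rewrite (fc (g v)) !gK.
Qed.

Lemma is_tree_aut_inv f : is_tree_aut f ->
  exists g, [/\ cancel f g, cancel g f & is_tree_aut g].
Proof.
move=> fP; have [[g fK gK] _ _] := fP.
by exists g; split=> //; apply: is_tree_aut_can fK gK.
Qed.

Definition tree_one : tree_aut := TreeAut is_tree_aut_id.

(* Products are read from left to right: first f, then g. *)
Definition tree_mul (f g : tree_aut) : tree_aut :=
  TreeAut (is_tree_aut_comp (tree_autP f) (tree_autP g)).

Definition tree_inv (f : tree_aut) : tree_aut :=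
  let: exist _ gP := cid (is_tree_aut_inv (tree_autP f)) in
  TreeAut (let: And3 _ _ h := gP in h).

Lemma tree_invK (f : tree_aut) : cancel f (tree_inv f).
Proof. by rewrite /tree_inv; case: cid => g [fK gK gP]. Qed.

Lemma tree_invKV (f : tree_aut) : cancel (tree_inv f) f.
Proof. by rewrite /tree_inv; case: cid => g [fK gK gP]. Qed.

HB.instance Definition _ := gen_eqMixin tree_aut.
HB.instance Definition _ := gen_choiceMixin tree_aut.

Lemma tree_mulA : associative tree_mul.
Proof. by move=> f g h; apply: tree_aut_ext. Qed.

Lemma tree_mul1 : left_id tree_one tree_mul.
Proof. by move=> f; apply: tree_aut_ext. Qed.

Lemma tree_mulr1 : right_id tree_one tree_mul.
Proof. by move=> f; apply: tree_aut_ext. Qed.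

Lemma tree_mulV : left_inverse tree_one tree_inv tree_mul.
Proof. by move=> f; apply: tree_aut_ext => w /=; rewrite tree_invKV. Qed.

Lemma tree_mulrV : right_inverse tree_one tree_inv tree_mul.
Proof. by move=> f; apply: tree_aut_ext => w /=; rewrite tree_invK. Qed.

HB.instance Definition _ := isGroup.Build tree_aut
  tree_mulA tree_mul1 tree_mulr1 tree_mulV tree_mulrV.

(* The automorphism induced by f on the subtree hanging from u: the unique
   h with f (u ++ w) = f u ++ h w. *)
Definition section_fun (f : word -> word) u w : word := drop (size u) (f (u ++ w)).

Lemma is_tree_aut_section f u : is_tree_aut f -> is_tree_aut (section_fun f u).
Proof.
move=> fP; have [g [fK gK gP]] := is_tree_aut_inv fP.
have fE w : f (u ++ w) = f u ++ section_fun f u w by exact: is_tree_aut_cat.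
have gE w : g (f u ++ w) = u ++ section_fun g (f u) w.
  by rewrite [LHS](is_tree_aut_cat _ _ gP) fK.
have catI v w1 w2 : v ++ w1 = v ++ w2 :> word -> w1 = w2.
  by move=> /eqP; rewrite eqseq_cat // => /andP[_ /eqP].
split.
- exists (section_fun g (f u)) => w.
    by apply: (catI u); rewrite -gE -fE fK.
  by apply: (catI (f u)); rewrite -fE -gE gK.
- by rewrite /section_fun cats0 drop_oversize // is_tree_aut_size.
move=> v w; have [_ _ fc] := fP.
by rewrite -(child_cat u) fc !fE child_cat.
Qed.

Definition section (f : tree_aut) u : tree_aut :=
  TreeAut (is_tree_aut_section u (tree_autP f)).

Lemma sectionE (f : tree_aut) u w : f (u ++ w) = f u ++ section f u w.
Proof. exact: is_tree_aut_cat (tree_autP f). Qed.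

Definition stab n : set tree_aut := [set g | forall w, size w = n -> g w = w].

Definition stab_in (G : set tree_aut) n : set tree_aut := stab n `&` G.

(* Only meant for elements of stab 1, on which it is the isomorphism onto the
   p-fold direct power of the automorphism group. *)
Definition psi (g : tree_aut) : 'I_p -> tree_aut := fun i => section g [:: i].

Definition direct_power (K : set tree_aut) : set ('I_p -> tree_aut) :=
  [set h | forall i, K (h i)].

Definition self_similar (G : set tree_aut) : Prop :=
  forall g u, G g -> G (section g u).

Definition spherically_transitive (G : set tree_aut) : Prop :=
  forall v w, size v = size w -> exists2 g, G g & g v = w.

Record weakly_regular_branch (G K : set tree_aut) : Prop := {
  wrb_group : is_subgroup G;
  wrb_self_similar : self_similar G;
  wrb_transitive : spherically_transitive G;
  wrb_subgroup : is_subgroup K;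
  wrb_stab : K `<=` stab_in G 1;
  wrb_neq1 : K <> [set 1];
  wrb_psi : direct_power K `<=` psi @` K }.

Definition regular_branch (G K : set tree_aut) : Prop :=
  weakly_regular_branch G K /\ finite_index K G.

(* ordS is the cyclic shift i |-> i + 1 (mod p). *)
Definition ggs_a_fun w : word := if w is x :: v then ordS x :: v else [::].

Lemma ggs_a_subproof : is_tree_aut ggs_a_fun.
Proof.
apply: (@mk_is_tree_aut _ (fun w => if w is x :: v then ord_pred x :: v else [::])).
- by case=> //= x w; rewrite ordSK.
- by case=> //= x w; rewrite ord_predK.
- by [].
by case=> [|y v] x; [exists (ordS x)|exists x].
Qed.

Definition ggs_a : tree_aut := TreeAut ggs_a_subproof.

End TreeAut.

Arguments psi {p} g i.
Arguments ggs_a {p}.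

Section GGS.
Variables (p : nat) (e : 'rV['F_p]_p.-1).
Local Notation word := (seq 'I_p).
Local Notation a := (ggs_a : tree_aut p).

(* insub x is None exactly for the last letter x, and Some x otherwise. The
   exponent e ord0 j is used through its representative in {0, ..., p - 1},
   which is harmless because a has order p. *)
Fixpoint ggs_b_fun (w : word) : word :=
  if w is x :: v then
    x :: (if (insub (val x) : option 'I_p.-1) is Some j
          then (a ^+ e ord0 j) v else ggs_b_fun v)
  else [::].

Lemma ggs_b_subproof : is_tree_aut ggs_b_fun.
Proof.
pose g := fix g (w : word) : word := if w is x :: v then
    x :: (if (insub (val x) : option 'I_p.-1) is Some j
          then tree_inv (a ^+ e ord0 j) v else g v) else [::].
apply: (@mk_is_tree_aut _ _ g).
- elim=> //= x v IHv; congr cons; case: insubP => [j _ _|_] //.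
  by rewrite tree_invK.
- elim=> //= x v IHv; congr cons; case: insubP => [j _ _|_] //.
  by rewrite tree_invKV.
- by [].
elim=> [|y v IHv] x /=.
  exists x; case: insubP => [j _ _|_] //=.
  by have [_ -> _] := tree_autP (a ^+ e ord0 j).
case: insubP => [j _ _|_]; last first.
  by have [z ->] := IHv x; exists z.
have [_ _ fc] := tree_autP (a ^+ e ord0 j).
by have [|z ->] := (fc v (rcons v x)).1; [exists x|exists z].
Qed.

Definition ggs_b : tree_aut p := TreeAut ggs_b_subproof.

Lemma ggs_b_stab : stab 1 ggs_b.
Proof.
case=> [|x [|y w]] //= _; congr cons; case: insubP => [j _ _|_] //=.
by have [_ -> _] := tree_autP (a ^+ e ord0 j).
Qed.

Lemma psi_ggs_b (i : 'I_p) : psi ggs_b i =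
  if (insub (val i) : option 'I_p.-1) is Some j then a ^+ e ord0 j else ggs_b.
Proof.
apply: tree_aut_ext => w; rewrite /= /section_fun /= drop0.
by case: insubP.
Qed.

Definition ggs_group : set (tree_aut p) := generated [set a; ggs_b].

Definition constant_vector : Prop := forall i j, e ord0 i = e ord0 j.

End GGS.

(* Main.v *)
Require Import Defs.
From mathcomp Require Import all_boot all_algebra.
From mathcomp Require Import all_classical.

(** Write S for the stabiliser of the first level in G, and b_k for the conjugate
    of b by a^k. Reading indices modulo p and E for the defining vector, psi(b_k)
    has b at the coordinate k and a^(E (j - k)) at every other coordinate j.

    The coordinate maps send S into G, so psi(gamma_3 S) lies in the direct power
    of gamma_3 G. For the reverse inclusion it suffices, by rotation, that
    gamma_3 G is contained in the subgroup N of those g for which some element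
    of gamma_3 S has coordinate g at one fixed place and 1 elsewhere. The
    coordinate maps send S onto G (psi_stab_surj), so N is normal in G. If s and
    t generate G and the commutator [s, t] is central modulo N, then G / N has
    class at most 2 (gamma3_generated2_sub), that is, gamma_3 G <= N. Hence it
    is enough to find x, y in S whose coordinates s, t at the fixed place generate
    G, and to find, for each h in G, some z in S which has coordinate h there and
    for which all other coordinates of [[x, y], z] are trivial
    (gamma3_supported_by_pair).

    Fix d with E d <> 0. The elements b_0 and b_d commute outside the coordinates
    0 and d, and at d they are a^(E d) and b, which generate G.
    - If E (-d) = 0, they also commute at 0, and any z will do.
    - If the pairs (E (k + d), E k), for k different from 0 and -d, are not all
      proportional, then products of the b_k supply a z with trivial coordinate 0
      and any prescribed coordinate d.
    - Otherwise E (k + d) = r E k, so the vector is a geometric progression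
      along the multiples of d, and r <> 1 since it is not constant. Then b_0
      b_d^(-r) is trivial away from the coordinates 0 and d; it is taken for x,
      and its conjugate by a^d, supported at d and 2d, for y. At the common
      coordinate d they are a^(E d) b^(-r) and b a^(-E d), which generate G
      because r <> 1.

    For the branch property, G / gamma_3 G is finite since it is nilpotent and
    generated by two elements of order p; gamma_3 G is in S because G acts on the
    first level through the powers of a; and it is not trivial, for otherwise
    all conjugates of b would commute (gamma3_neq1). *)

Set Implicit Arguments.
Unset Strict Implicit.
Unset Printing Implicit Defensive.

Import GRing.Theory.

Local Open Scope classical_set_scope.
Local Open Scope group_scope.

(** * Commutator identities *)

Section CommutatorIdentities.
Variable gT : groupType.
Implicit Types x y z : gT.

Lemma commgMr x y z : [~ x, y * z] = [~ x, z] * [~ x, y] ^ z.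
Proof. by rewrite !commgEr -[RHS]mulgA -conjgC invgM conjMg !mulgA. Qed.

Lemma commgVr x y : [~ x, y^-1] = ([~ x, y] ^ y^-1)^-1.
Proof.
by apply: (mulIg ([~ x, y] ^ y^-1)); rewrite -commgMr mulgV commg1 mulVg.
Qed.

Lemma commgJl x y z : [~ x ^ z, y] = [~ x, y ^ z^-1] ^ z.
Proof. by rewrite conjRg conjgKV. Qed.

Lemma conjg_mulR x y : x ^ y = x * [~ x, y].
Proof. by rewrite commgEl mulVKg. Qed.

End CommutatorIdentities.

(** * Generated subgroups and the lower central series *)

Section Subgroups.
Variable gT : groupType.
Implicit Types (A B H N : set gT).

Lemma subgroupM H x y : is_subgroup H -> H x -> H y -> H (x * y).
Proof. by case=> _ + _; apply. Qed.

Lemma subgroupV H x : is_subgroup H -> H x -> H x^-1.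
Proof. by case=> _ _; apply. Qed.

Lemma subgroupX H x n : is_subgroup H -> H x -> H (x ^+ n).
Proof.
move=> Hg Hx; elim: n => [|n IHn]; first by case: Hg.
by rewrite expgS; apply: subgroupM.
Qed.

Lemma subgroupJ H x y : is_subgroup H -> H x -> H y -> H (x ^ y).
Proof.
move=> Hg Hx Hy; rewrite conjgE; do !apply: subgroupM => //.
exact: subgroupV.
Qed.

Lemma subgroupR H x y : is_subgroup H -> H x -> H y -> H [~ x, y].
Proof.
move=> Hg Hx Hy; rewrite commgEl; apply: subgroupM => //.
  exact: subgroupV.
exact: subgroupJ.
Qed.

Lemma generated_subgroup A : is_subgroup (generated A).
Proof.
split=> [M [[]]//|x y Ax Ay M MP|x Ax M MP].
  by apply: subgroupM; [case: MP|apply: Ax|apply: Ay].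
by apply: subgroupV; [case: MP|apply: Ax].
Qed.

Lemma mem_generated A : A `<=` generated A.
Proof. exact: sub_gen_smallest. Qed.

Lemma generated_sub A H : is_subgroup H -> A `<=` H -> generated A `<=` H.
Proof. exact: smallest_sub. Qed.

Lemma commutator_sub A B H : is_subgroup H ->
  (forall x y, A x -> B y -> H [~ x, y]) -> commutator_subgroup A B `<=` H.
Proof.
by move=> Hg ABH; apply: generated_sub => // z [x [y [Ax By ->]]]; apply: ABH.
Qed.

Lemma mem_commutator A B x y : A x -> B y -> commutator_subgroup A B [~ x, y].
Proof. by move=> Ax By; apply: mem_generated; exists x, y. Qed.

Lemma gamma_rec_subgroup n H : is_subgroup H -> is_subgroup (gamma_rec n H).
Proof. by case: n => //= n _; apply: generated_subgroup. Qed.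

Lemma gamma_rec_sub n H : is_subgroup H -> gamma_rec n H `<=` H.
Proof.
move=> Hg; elim: n => //= n IHn; apply: commutator_sub => // x y /IHn Hx Hy.
exact: subgroupR.
Qed.

Definition normalised_by H N := forall x h, N x -> H h -> N (x ^ h).

(** Rewriting [x, y z] as a product of conjugates of [x, z] and [x, y] shows
    that centralising x modulo N is compatible with products; this replaces
    the centraliser of the image of x in the quotient H / N. *)
Lemma centraliser_mod_subgroup N H x :
  is_subgroup N -> is_subgroup H -> normalised_by H N ->
  is_subgroup [set y | H y /\ N [~ x, y]].
Proof.
move=> Ng Hg NH; split=> [|y z [Hy Ny] [Hz Nz]|y [Hy Ny]] /=.
- by rewrite commg1; case: Hg; case: Ng.
- split; first exact: subgroupM.
  by rewrite commgMr; apply: subgroupM => //; apply: NH.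
split; first exact: subgroupV.
by rewrite commgVr; apply: subgroupV => //; apply: NH => //; apply: subgroupV.
Qed.

Lemma commutator_generated_sub A N : is_subgroup N ->
  normalised_by (generated A) N -> (forall x y, A x -> A y -> N [~ x, y]) ->
  commutator_subgroup (generated A) (generated A) `<=` N.
Proof.
move=> Ng NH AN; have Hg := generated_subgroup A.
have AH x y : A x -> generated A y -> N [~ x, y].
  move=> Ax Hy; have [] // : [set y | generated A y /\ N [~ x, y]] y.
  apply: generated_sub Hy; first exact: centraliser_mod_subgroup.
  by move=> z Az; split; [apply: mem_generated|apply: AN].
apply: commutator_sub => // x y Hx Hy; rewrite -invgR; apply: subgroupV => //.
have [] // : [set x | generated A x /\ N [~ y, x]] x.
apply: generated_sub Hx; first exact: centraliser_mod_subgroup.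
move=> z Az; split; first exact: mem_generated.
by rewrite -invgR; apply: subgroupV => //; apply: AH.
Qed.

(** A two-generator group in which the commutator of the generators is central
    has class at most two; here the class is taken modulo N. *)
Lemma gamma3_generated2_sub s t N : is_subgroup N ->
  normalised_by (generated [set s; t]) N ->
  N [~ [~ s, t], s] -> N [~ [~ s, t], t] ->
  gamma 3 (generated [set s; t]) `<=` N.
Proof.
set H := generated _ => Ng NH Ns Nt.
have Hg : is_subgroup H by exact: generated_subgroup.
have Hs : H s by apply: mem_generated; left.
have Ht : H t by apply: mem_generated; right.
pose C := [set x | H x /\ forall h, H h -> N [~ x, h]].
have NC x y : N [~ x, y] -> N [~ y, x].
  by move=> Nxy; rewrite -invgR; apply: (subgroupV Ng).
have Cg : is_subgroup C.
  split=> [|x y [Hx Cx] [Hy Cy]|x [Hx Cx]].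
  - by split=> [|h _]; rewrite ?comm1g; [case: Hg|case: Ng].
  - split=> [|h Hh]; first by apply: (subgroupM Hg).
    have Zg := centraliser_mod_subgroup h Ng Hg NH; apply: (NC).
    by have [] := subgroupM Zg (conj Hx (NC _ _ (Cx _ Hh)))
                              (conj Hy (NC _ _ (Cy _ Hh))).
  split=> [|h Hh]; first exact: (subgroupV Hg).
  have Zg := centraliser_mod_subgroup h Ng Hg NH; apply: (NC).
  by have [] := subgroupV Zg (conj Hx (NC _ _ (Cx _ Hh))).
have CH : normalised_by H C.
  move=> x h [Hx Cx] Hh; split=> [|g Hg']; first exact: (subgroupJ Hg).
  rewrite commgJl; apply: (NH) => //; apply: Cx; apply: (subgroupJ Hg) => //.
  exact: (subgroupV Hg).
have Cst : C [~ s, t].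
  split=> [|h Hh]; first exact: (subgroupR Hg).
  have [] // : [set y | H y /\ N [~ [~ s, t], y]] h.
  apply: generated_sub Hh; first exact: (centraliser_mod_subgroup _ Ng Hg).
  by move=> z [] ->.
apply: commutator_sub => // x h G'x Hh; suff [_ Cx] : C x by apply: Cx.
apply: commutator_generated_sub G'x => //.
have C1 : C 1 by case: Cg.
move=> y z [->|->] [->|->]; rewrite ?commgg //.
by rewrite -invgR; apply: (subgroupV Cg).
Qed.

End Subgroups.

(** Partial homomorphisms are needed because the coordinates of psi are
    multiplicative only on the stabiliser of the first level. *)
Lemma gamma_rec_map (gT hT : groupType) (f : gT -> hT) (H : set gT)
    (H' : set hT) n x :
  is_subgroup H -> is_subgroup H' ->
  (forall x y, H x -> H y -> f (x * y) = f x * f y) ->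
  (forall x, H x -> H' (f x)) -> gamma_rec n H x -> gamma_rec n H' (f x).
Proof.
move=> Hg H'g fM fH; have H1 : H 1 by case: Hg.
have f1 : f 1 = 1 by apply: (mulgI (f 1)); rewrite -fM // !mulg1.
have fV y : H y -> f y^-1 = (f y)^-1.
  move=> Hy; apply: (mulgI (f y)).
  by rewrite -fM ?mulgV //; apply: subgroupV.
have fR y z : H y -> H z -> f [~ y, z] = [~ f y, f z].
  move=> Hy Hz; rewrite !commgEl !conjgE.
  by do !rewrite ?fM ?fV //; do ?[apply: subgroupV|apply: subgroupM] => //.
elim: n x => [|n IHn] x //= Kx; first exact: fH.
pose P := [set x | H x /\ gamma_rec n.+1 H' (f x)].
have Kg : is_subgroup (gamma_rec n.+1 H') by exact: gamma_rec_subgroup.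
have [] // : P x; apply: commutator_sub Kx.
  split=> [|y z [Hy Ky] [Hz Kz]|y [Hy Ky]].
  - by split=> //; rewrite f1; case: Kg.
  - by split; [exact: subgroupM|rewrite fM //; apply: (subgroupM Kg)].
  by split; [exact: subgroupV|rewrite fV //; apply: (subgroupV Kg)].
move=> y z Ky Hz; have Hy := gamma_rec_sub Hg Ky.
split; first exact: subgroupR.
by rewrite fR //; apply: mem_commutator; [apply: IHn|apply: fH].
Qed.

Lemma gamma_rec_normal (gT : groupType) n (H : set gT) :
  is_subgroup H -> normalised_by H (gamma_rec n H).
Proof.
move=> Hg x h Kx Hh; apply: (gamma_rec_map (f := fun x => x ^ h)) Kx => //.
  by move=> y z _ _; rewrite conjMg.
by move=> y Hy; apply: subgroupJ.
Qed.

(** * The index of the third term of the lower central series *)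

Section FiniteIndex.
Variable gT : groupType.
Implicit Types (H N : set gT).

(** The subgroup N <x>; non-negative powers of x suffice as soon as some positive
    power of x lies in N. *)
Definition adjoin N x : set gT := [set z | exists y i, N y /\ z = y * x ^+ i].

Lemma adjoin_sub N x : N `<=` adjoin N x.
Proof. by move=> y Ny; exists y, 0; rewrite mulg1. Qed.

Lemma mem_adjoin N x : is_subgroup N -> adjoin N x x.
Proof. by case=> N1 _ _; exists 1, 1%N; rewrite mul1g. Qed.

Lemma adjoin_bounded N x n z : 0 < n -> is_subgroup N -> N (x ^+ n) ->
  adjoin N x z -> exists y (i : 'I_n), N y /\ z = y * x ^+ i.
Proof.
move=> n_gt0 Ng Nxn [y [i [Ny ->]]].
have imod : i %% n < n by rewrite ltn_mod.
exists (y * x ^+ n ^+ (i %/ n)), (Ordinal imod); split.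
  by apply: subgroupM => //; apply: subgroupX.
by rewrite -mulgA -expgnA -expgnDr /= mulnC -divn_eq.
Qed.

Lemma adjoin_subgroup N H x n : 0 < n -> is_subgroup N -> is_subgroup H ->
  normalised_by H N -> H x -> N (x ^+ n) -> is_subgroup (adjoin N x).
Proof.
move=> n_gt0 Ng Hg NH Hx Nxn; split.
- by apply: adjoin_sub; case: Ng.
- move=> _ _ [y [i [Ny ->]]] [z [j [Nz ->]]].
  exists (y * z ^ (x ^+ i)^-1), (i + j)%N; split.
    apply: subgroupM => //; apply: NH => //.
    by apply: subgroupV => //; apply: subgroupX.
  by rewrite expgnDr conjgE invgK !mulgA mulgVK.
move=> _ [y [i [Ny ->]]].
(* x^-i = (x^n)^-i x^((n-1) i), whose first factor lies in N. *)
exists ((y^-1) ^ (x ^+ i) * (x ^+ n ^+ i)^-1), (n.-1 * i)%N; split.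
  apply: subgroupM => //; last by apply: subgroupV => //; apply: subgroupX.
  by apply: NH; [apply: subgroupV|apply: subgroupX].
rewrite conjgE invgM -[LHS]mulg1 -!mulgA; congr (_ * (_ * _)).
have -> : x ^+ n ^+ i = x ^+ (n.-1 * i) * x ^+ i.
  by rewrite -expgnA -expgnDr -mulSnr prednK.
by rewrite invgM mulgVK mulgV.
Qed.

(** Along K = gamma 3 H <= K <[a, b]> = H' <= H' <b> <= H' <b> <a> = H, each
    step adjoins one element of finite order modulo the previous term; the
    order of [a, b] modulo K divides that of a, since [a^i, b] is congruent to
    [a, b]^i modulo K. *)
Lemma finite_index_gamma3 (a b : gT) n : 0 < n -> a ^+ n = 1 -> b ^+ n = 1 ->
  finite_index (gamma 3 (generated [set a; b])) (generated [set a; b]).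
Proof.
move=> n_gt0 an bn; set H := generated _.
have Hg : is_subgroup H := generated_subgroup _.
have Ha : H a by apply: mem_generated; left.
have Hb : H b by apply: mem_generated; right.
pose K := gamma 3 H; pose H' := gamma 2 H; pose c := [~ a, b].
have Kg : is_subgroup K := gamma_rec_subgroup 2 Hg.
have KH : normalised_by H K := @gamma_rec_normal _ 2 _ Hg.
have H'g : is_subgroup H' := gamma_rec_subgroup 1 Hg.
have H'H : normalised_by H H' := @gamma_rec_normal _ 1 _ Hg.
have H'c : H' c by apply: mem_commutator.
have Hc : H c by apply: (subgroupR Hg).
have Kc x : H x -> K [~ c, x] by move=> Hx; apply: mem_commutator.
have Kcn : K (c ^+ n).
  have Kac i : K ([~ a ^+ i, b] * c ^- i).
    elim: i => [|i IHi]; first by rewrite comm1g mul1g invg1; case: Kg.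
    have -> : [~ a ^+ i.+1, b] = [~ a ^+ i, b] ^ a * c.
      by rewrite expgSr -invgR commgMr invgM -conjVg !invgR.
    have H'ai : H' [~ a ^+ i, b].
      by apply: mem_commutator => //; apply: (subgroupX _ Hg).
    rewrite expgSr invgM mulgA mulgK conjg_mulR -mulgA (conjgC [~ _, a]) mulgA.
    apply: (subgroupM Kg) => //; apply: KH; first exact: mem_commutator.
    by apply: (subgroupV Hg); apply: (subgroupX _ Hg).
  by have := Kac n; rewrite an comm1g mul1g => /(subgroupV Kg); rewrite invgK.
have H1g : is_subgroup (adjoin K c) by exact: (adjoin_subgroup n_gt0 Kg Hg).
have H'K : H' `<=` adjoin K c.
  apply: commutator_generated_sub => //; rewrite -/H.
    move=> _ h [y [i [Ky ->]]] Hh; rewrite conjMg conjXg.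
    apply: (subgroupM H1g); first by apply: adjoin_sub; apply: KH.
    apply: (subgroupX _ H1g); rewrite conjg_mulR.
    apply: (subgroupM H1g); first exact: mem_adjoin.
    by apply: adjoin_sub; apply: Kc.
  have c1 := mem_adjoin c Kg.
  move=> _ _ [->|->] [->|->]; rewrite ?commgg //; try by case: H1g.
  by rewrite -invgR; apply: (subgroupV H1g).
have H'bg : is_subgroup (adjoin H' b).
  by apply: (adjoin_subgroup n_gt0 H'g Hg) => //; rewrite bn; case: H'g.
have H'bH : normalised_by H (adjoin H' b).
  move=> _ h [y [i [Ky ->]]] Hh; rewrite conjMg conjXg.
  apply: (subgroupM H'bg); first by apply: adjoin_sub; apply: H'H.
  apply: (subgroupX _ H'bg); rewrite conjg_mulR.
  apply: (subgroupM H'bg); first exact: mem_adjoin.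
  by apply: adjoin_sub; apply: mem_commutator.
have H'bn : adjoin H' b (a ^+ n) by rewrite an; case: H'bg.
have HE : H `<=` adjoin (adjoin H' b) a.
  apply: generated_sub.
    exact: (adjoin_subgroup n_gt0 H'bg Hg).
  move=> _ [->|->]; first exact: mem_adjoin.
  by apply: adjoin_sub; apply: mem_adjoin.
pose coset (u : 'I_n * 'I_n * 'I_n) :=
  [set k * (c ^+ u.1.1 * b ^+ u.1.2 * a ^+ u.2) | k in K].
apply: (@sub_finite_set _ _ (coset @` setT)); last exact: finite_image.
move=> _ [h Hh <-]; have [y [l [+ ->]]] :=
  adjoin_bounded n_gt0 H'bg H'bn (HE h Hh).
have H'bn' : H' (b ^+ n) by rewrite bn; case: H'g.
move=> /(adjoin_bounded n_gt0 H'g H'bn')[z [j [+ ->]]].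
move=> /H'K /(adjoin_bounded n_gt0 Kg Kcn)[k [i [Kk ->]]].
exists (i, j, l) => //; apply/seteqP; split=> _ /= [x Kx <-].
  exists (x * k^-1).
    by apply: (subgroupM Kg) => //; apply: (subgroupV Kg).
  by rewrite !mulgA mulgVK.
by exists (x * k); [apply: (subgroupM Kg)|rewrite !mulgA].
Qed.

End FiniteIndex.

(** * Exponents modulo a prime *)

Section PrimeExponents.
Variables (p : nat) (p_prime : prime p) (gT : groupType) (x : gT).
Hypothesis xp : x ^+ p = 1.
Implicit Types u v : 'F_p.

Lemma expg_mod_order m : x ^+ (m %% p) = x ^+ m.
Proof. by rewrite {2}(divn_eq m p) expgnDr mulnC expgnA xp expg1n mul1g. Qed.

Lemma expg_FpD u v : x ^+ (u + v)%R = x ^+ u * x ^+ v.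
Proof. by rewrite /= [X in _ %% X]Fp_cast // expg_mod_order expgnDr. Qed.

Lemma expg_FpM u v : x ^+ (u * v)%R = x ^+ u ^+ v.
Proof. by rewrite /= [X in _ %% X]Fp_cast // expg_mod_order expgnA. Qed.

Lemma expg_Fp1 : x ^+ (1 : 'F_p)%R = x.
Proof. by rewrite /= modn_small // expg1. Qed.

Lemma expg_FpN u : x ^+ (- u)%R = x ^- u.
Proof. by apply: (mulgI (x ^+ u)); rewrite -expg_FpD subrr mulgV. Qed.

Lemma expg_FpK u : u != 0%R -> x ^+ u ^+ (u^-1)%R = x.
Proof. by move=> u0; rewrite -expg_FpM divff // expg_Fp1. Qed.

End PrimeExponents.

(** * Coordinates of automorphisms stabilising the first level *)

Section FirstLevel.
Variable p : nat.
Implicit Types (f g h : tree_aut p) (i : 'I_p).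

Lemma tree_mulE f g w : (f * g) w = g (f w).
Proof. by []. Qed.

Lemma tree_aut_size g w : size (g w) = size w.
Proof. exact: is_tree_aut_size (tree_autP g). Qed.

Lemma tree_autK g w : g^-1 (g w) = w.
Proof. by rewrite -tree_mulE mulgV. Qed.

Lemma stab1_cons g i w : stab 1 g -> g (i :: w) = i :: psi g i w.
Proof. by move=> gS; rewrite -cat1s sectionE gS. Qed.

Lemma psi_eq g h i : (forall w, g (i :: w) = i :: h w) -> psi g i = h.
Proof.
move=> gE; apply: tree_aut_ext => w.
by rewrite /= /section_fun gE /= drop0.
Qed.

Lemma stab1_subgroup : is_subgroup (stab 1 : set (tree_aut p)).
Proof.
split=> [//|f g fS gS w w1|f fS w w1]; first by rewrite tree_mulE fS // gS.
by rewrite -{1}(fS w w1) tree_autK.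
Qed.

Lemma stab1J f g : stab 1 f -> stab 1 (f ^ g).
Proof.
move=> fS w w1; rewrite conjgE !tree_mulE fS ?tree_aut_size //.
by rewrite -tree_mulE mulVg.
Qed.

Lemma psi1 i : psi 1 i = 1.
Proof. exact: psi_eq. Qed.

Lemma psiM f g i : stab 1 f -> stab 1 g -> psi (f * g) i = psi f i * psi g i.
Proof.
by move=> fS gS; apply: psi_eq => w; rewrite tree_mulE !stab1_cons.
Qed.

Lemma psiV f i : stab 1 f -> psi f^-1 i = (psi f i)^-1.
Proof.
move=> fS; have fVS := subgroupV stab1_subgroup fS.
by apply: (mulgI (psi f i)); rewrite -psiM // !mulgV psi1.
Qed.

Lemma psiX f i n : stab 1 f -> psi (f ^+ n) i = psi f i ^+ n.
Proof.
move=> fS; elim: n => [|n IHn]; first exact: psi1.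
by rewrite !expgS psiM ?IHn //; apply: subgroupX stab1_subgroup _.
Qed.

Lemma psiJ f g i : stab 1 f -> stab 1 g -> psi (f ^ g) i = psi f i ^ psi g i.
Proof.
move=> fS gS; have gVS := subgroupV stab1_subgroup gS.
by rewrite !conjgE !psiM ?psiV //; apply: subgroupM stab1_subgroup _ _.
Qed.

Lemma psiR f g i : stab 1 f -> stab 1 g ->
  psi [~ f, g] i = [~ psi f i, psi g i].
Proof.
move=> fS gS; rewrite !commgEl psiM ?psiJ ?psiV //; last exact: stab1J.
exact: subgroupV stab1_subgroup fS.
Qed.

Lemma section_mul f g u : section (f * g) u = section f u * section g (f u).
Proof.
apply: tree_aut_ext => w; have := sectionE (f * g) u w.
rewrite !tree_mulE (sectionE f) (sectionE g) => /eqP.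
by rewrite eqseq_cat // => /andP[_ /eqP ->].
Qed.

Lemma section_nil f : section f [::] = f.
Proof. by apply: tree_aut_ext => w; rewrite /= /section_fun drop0. Qed.

Lemma section_cons f i u : stab 1 f -> section f (i :: u) = section (psi f i) u.
Proof.
move=> fS; apply: tree_aut_ext => w.
by rewrite /= {1}/section_fun cat_cons stab1_cons.
Qed.

Lemma sections_subgroup (H : set (tree_aut p)) : is_subgroup H ->
  is_subgroup [set f | forall u, H (section f u)].
Proof.
move=> Hg; have s1 u : section (1 : tree_aut p) u = 1.
  by apply: tree_aut_ext => w; rewrite /= /section_fun drop_size_cat.
split=> [u|f g Hf Hh u|f Hf u]; first by rewrite s1; case: Hg.
  by rewrite section_mul; apply: subgroupM.
suff -> : section f^-1 u = (section f (f^-1 u))^-1 by apply: subgroupV.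
by apply: (mulIg (section f (f^-1 u))); rewrite -section_mul !mulVg s1.
Qed.

Lemma psi_image_subgroup i (P : set (tree_aut p)) : is_subgroup P ->
  P `<=` stab 1 -> is_subgroup [set psi x i | x in P].
Proof.
move=> Pg PS; split.
- by exists 1; [case: Pg|rewrite psi1].
- move=> _ _ [x Px <-] [y Py <-]; exists (x * y); first exact: subgroupM.
  by rewrite psiM //; apply: PS.
move=> _ [x Px <-]; exists x^-1; first exact: subgroupV.
by rewrite psiV //; apply: PS.
Qed.

End FirstLevel.

(** * Letters modulo p and the rooted automorphism *)

Section Letters.
Variables (p : nat) (p_prime : prime p).
Implicit Types j k : 'F_p.

(** The letter k of {1, ..., p}, read modulo p: the residue 0 names the last
    letter, at which b reproduces itself. *)
Definition letter k : 'I_p := cast_ord (Fp_cast p_prime) (k - 1)%R.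

Lemma letter_inj : injective letter.
Proof. by move=> j k /cast_ord_inj/addIr. Qed.

Lemma letterP i : exists k, letter k = i.
Proof.
exists (cast_ord (esym (Fp_cast p_prime)) i + 1)%R.
by rewrite /letter addrK cast_ordKV.
Qed.

Lemma val_Fp_succ k : (k + 1)%R = k.+1 %% p :> nat.
Proof. by rewrite /= [X in _ %% X]Fp_cast // addn1. Qed.

Lemma letter_succ k : (letter k).+1 %% p = k :> nat.
Proof. by rewrite -[in RHS](subrK 1%R k) val_Fp_succ. Qed.

Lemma ltn_letter k : (letter k < p.-1) = (k != 0%R).
Proof.
rewrite ltn_predRL -(inj_eq val_inj) -[X in X == _]letter_succ /=.
have [lt_kp|le_pk] := ltnP (letter k).+1 p; first by rewrite modn_small.
suff -> : (letter k).+1 = p by rewrite modnn.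
by apply/eqP; rewrite eqn_leq le_pk ltn_ord.
Qed.

Lemma ordS_letter k : ordS (letter k) = letter (k + 1)%R.
Proof.
rewrite /letter addrK; apply: val_inj.
exact: letter_succ.
Qed.

Lemma ggs_aX_letter n k w :
  ((ggs_a : tree_aut p) ^+ n) (letter k :: w) = letter (k + n%:R)%R :: w.
Proof.
elim: n => [|n IHn] in k *; first by rewrite addr0.
by rewrite expgS tree_mulE /= ordS_letter IHn -addrA nat1r.
Qed.

Lemma ggs_a_order : (ggs_a : tree_aut p) ^+ p = 1.
Proof.
apply: tree_aut_ext => -[|i w].
  by apply/size0nil; rewrite tree_aut_size.
by have [k <-] := letterP i; rewrite ggs_aX_letter pchar_Fp_0 ?addr0.
Qed.

Lemma psi_conj_aX (g : tree_aut p) j k : stab 1 g ->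
  psi (g ^ (ggs_a ^+ j)) (letter k) = psi g (letter (k - j)%R).
Proof.
move=> gS; apply: psi_eq => w.
rewrite conjgE !tree_mulE -expg_FpN ?ggs_a_order //.
by rewrite ggs_aX_letter natr_Zp stab1_cons // ggs_aX_letter natr_Zp subrK.
Qed.

End Letters.

(** * Action of a GGS-group on the tree *)

Section GGSGroup.
Variables (p : nat) (p_prime : prime p) (e : 'rV['F_p]_p.-1).
Implicit Types j k d : 'F_p.
Local Notation a := (ggs_a : tree_aut p).
Local Notation b := (ggs_b e).
Local Notation G := (ggs_group e).
Local Notation S := (stab_in (ggs_group e) 1).
Local Notation letter := (letter p_prime).

(** The defining vector with indices read modulo p, extended by 0 at 0. *)
Definition exponent k : 'F_p :=
  if (insub (val (letter k)) : option 'I_p.-1) is Some j then e ord0 j else 0%R.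

Lemma exponent_ord (x : 'I_p.-1) : exists2 k, k != 0%R & exponent k = e ord0 x.
Proof.
have xp : x < p by rewrite (leq_trans (ltn_ord x)) ?leq_pred.
have [k kE] := letterP p_prime (Ordinal xp); exists k; last first.
  by rewrite /exponent kE /= insubT //= => xp'; congr (e _ _); apply: val_inj.
by rewrite -(ltn_letter p_prime) kE /=.
Qed.

Lemma ggs_b_letter k :
  psi b (letter k) = if k == 0%R then b else a ^+ exponent k.
Proof.
rewrite psi_ggs_b /exponent; case: insubP => [j jp _|].
  by move: jp; rewrite (ltn_letter p_prime) => /negPf ->.
by rewrite (ltn_letter p_prime) negbK => ->.
Qed.

Lemma ggs_b_order : b ^+ p = 1.
Proof.
have bX n k w :
    (b ^+ n) (letter k :: w) = letter k :: (psi b (letter k) ^+ n) w.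
  have bS := subgroupX n (@stab1_subgroup p) (ggs_b_stab e).
  by rewrite stab1_cons // psiX //; apply: ggs_b_stab.
apply: tree_aut_ext; elim=> [|i w IHw].
  by apply/size0nil; rewrite tree_aut_size.
have [k <-] := letterP p_prime i; rewrite bX ggs_b_letter; case: eqP => [_|_].
  by rewrite IHw.
by rewrite expgnAC ggs_a_order // expg1n.
Qed.

Definition ggs_bconj k : tree_aut p := b ^ (a ^+ k).

Lemma ggs_bconj_letter k j : psi (ggs_bconj k) (letter j) =
  if j == k then b else a ^+ exponent (j - k)%R.
Proof.
by rewrite psi_conj_aX ?ggs_b_letter ?subr_eq0 //; apply: ggs_b_stab.
Qed.

Lemma ggs_subgroup : is_subgroup G.
Proof. exact: generated_subgroup. Qed.

Lemma ggs_mem_a : G a.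
Proof. by apply: mem_generated; left. Qed.

Lemma ggs_mem_b : G b.
Proof. by apply: mem_generated; right. Qed.

Lemma stab_in_subgroup : is_subgroup S.
Proof.
have [s1 sM sV] := @stab1_subgroup p; have [g1 gM gV] := ggs_subgroup.
by split=> [//|x y [? ?] [? ?]|x [? ?]]; split;
  [apply: sM|apply: gM|apply: sV|apply: gV].
Qed.

Lemma stab_in_conj x g : S x -> G g -> S (x ^ g).
Proof.
by move=> [Sx Gx] Gg; split; [apply: stab1J|apply: subgroupJ ggs_subgroup _ _].
Qed.

Lemma ggs_bconj_stab k : S (ggs_bconj k).
Proof.
apply: stab_in_conj; first by split; [apply: ggs_b_stab|apply: ggs_mem_b].
exact: subgroupX ggs_subgroup ggs_mem_a.
Qed.

Lemma ggs_sub (H : set (tree_aut p)) : is_subgroup H -> H a -> H b -> G `<=` H.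
Proof. by move=> Hg Ha Hb; apply: generated_sub => // _ [->|->]. Qed.

Lemma ggs_self_similar : self_similar G.
Proof.
have Hg := sections_subgroup ggs_subgroup.
suff GH : G `<=` [set f | forall u, G (section f u)] by move=> g u /GH.
have Ha : forall u, G (section a u).
  case=> [|x u]; first by rewrite section_nil; apply: ggs_mem_a.
  suff -> : section a (x :: u) = 1 by case: ggs_subgroup.
  by apply: tree_aut_ext => w; rewrite /= /section_fun /= drop_size_cat.
apply: ggs_sub => //; elim=> [|x u IHu].
  by rewrite section_nil; apply: ggs_mem_b.
rewrite section_cons; last exact: ggs_b_stab.
have [k <-] := letterP p_prime x; rewrite ggs_b_letter; case: eqP => // _.
exact: (subgroupX (exponent k) Hg Ha).
Qed.

Lemma psi_ggs x i : G x -> G (psi x i).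
Proof. exact: ggs_self_similar. Qed.

(** At the coordinate k, the conjugate b_k is b and b_(k - d) is a^(E d). *)
Lemma psi_stab_surj d k : exponent d != 0%R ->
  G `<=` [set psi x (letter k) | x in S].
Proof.
move=> Ed; have Sg : is_subgroup [set psi x (letter k) | x in S].
  by apply: psi_image_subgroup stab_in_subgroup _ => x [].
apply: ggs_sub => //; last first.
  exists (ggs_bconj k); first exact: ggs_bconj_stab.
  by rewrite ggs_bconj_letter eqxx.
have d0 : d != 0%R.
  by apply: contraNneq Ed => ->; rewrite /exponent insubF // ltn_letter eqxx.
rewrite -(expg_FpK p_prime (ggs_a_order p_prime) Ed).
apply: (subgroupX _ Sg); exists (ggs_bconj (k - d)%R).
  exact: ggs_bconj_stab.
rewrite ggs_bconj_letter subKr; case: eqP => // /eqP.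
by rewrite -subr_eq0 subKr (negPf d0).
Qed.

(** Rotate the first letter to the place of the last one, then act on the
    remaining letters through a stabiliser element with prescribed section. *)
Lemma ggs_transitive d : exponent d != 0%R -> spherically_transitive G.
Proof.
move=> Ed; pose root n := nseq n (letter 0%R).
suff to_root v : exists2 g, G g & g v = root (size v).
  move=> v w vw; have [g Gg gv] := to_root v; have [h Gh hw] := to_root w.
  exists (g * h^-1).
    exact: subgroupM ggs_subgroup _ (subgroupV ggs_subgroup _).
  by rewrite tree_mulE gv vw -hw tree_autK.
elim: v => [|x v [h Gh hv]].
  by exists 1; [case: ggs_subgroup|].
have [k <-] := letterP p_prime x.
have [y Sy yh] := psi_stab_surj 0%R Ed Gh; have [y1 Gy] := Sy.
exists (a ^+ (- k)%R * y).
  apply: subgroupM ggs_subgroup _ _ => //.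
  exact: subgroupX ggs_subgroup ggs_mem_a.
by rewrite tree_mulE ggs_aX_letter natr_Zp subrr stab1_cons // yh hv.
Qed.

End GGSGroup.

(** * Lifting the third term of the lower central series to one coordinate *)

Section Branching.
Variables (p : nat) (p_prime : prime p) (p_odd : odd p) (e : 'rV['F_p]_p.-1).
Implicit Types j k d : 'F_p.
Local Notation a := (ggs_a : tree_aut p).
Local Notation b := (ggs_b e).
Local Notation G := (ggs_group e).
Local Notation S := (stab_in (ggs_group e) 1).
Local Notation letter := (letter p_prime).
Local Notation E := (exponent p_prime e).

(** Being normal in G, this subgroup contains gamma_3 G as soon as it contains
    two well chosen triple commutators. *)
Definition supported k : set (tree_aut p) := [set g | exists2 x,
  gamma 3 S x & forall j, psi x (letter j) = if j == k then g else 1].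

Lemma gamma3_stab x : gamma 3 S x -> S x.
Proof. exact: (gamma_rec_sub (n := 2) (stab_in_subgroup e)). Qed.

Lemma gamma3_stab_subgroup : is_subgroup (gamma 3 S).
Proof. exact: (gamma_rec_subgroup 2 (stab_in_subgroup e)). Qed.

Lemma gamma3_stab_conj x g : gamma 3 S x -> G g -> gamma 3 S (x ^ g).
Proof.
have Sg := stab_in_subgroup e.
move=> Tx Gg; apply: (gamma_rec_map (f := fun x => x ^ g)) Tx => //.
  by move=> y z _ _; rewrite conjMg.
by move=> y Sy; apply: stab_in_conj.
Qed.

Lemma supported_subgroup k : is_subgroup (supported k).
Proof.
have Tg := gamma3_stab_subgroup; split.
- by exists 1 => [|j]; [case: Tg|rewrite psi1 if_same].
- move=> g h [x Tx xE] [y Ty yE]; exists (x * y); first exact: (subgroupM Tg).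
  have [[xS _] [yS _]] := (gamma3_stab Tx, gamma3_stab Ty).
  by move=> j; rewrite psiM // xE yE; case: eqP; rewrite ?mulg1.
move=> g [x Tx xE]; exists x^-1 => [|j]; first exact: (subgroupV Tg).
have [xS _] := gamma3_stab Tx.
by rewrite psiV // xE; case: eqP; rewrite ?invg1.
Qed.

Lemma supported_rotate k d : supported k `<=` supported (k + d)%R.
Proof.
move=> g [x Tx xE]; exists (x ^ (a ^+ d)) => [|j].
  apply: gamma3_stab_conj => //.
  exact: (subgroupX _ (ggs_subgroup e) (@ggs_mem_a p e)).
have [xS _] := gamma3_stab Tx.
by rewrite psi_conj_aX // xE subr_eq.
Qed.

Section NonZeroExponent.
Variable d : 'F_p.
Hypothesis Ed : E d != 0%R.

Lemma supported_normal k : normalised_by G (supported k).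
Proof.
move=> g h [x Tx xE] /(psi_stab_surj k Ed)[y [yS Gy] <-].
exists (x ^ y) => [|j]; first exact: gamma3_stab_conj.
have [xS _] := gamma3_stab Tx.
by rewrite psiJ // xE; case: eqP => [->//|]; rewrite conj1g.
Qed.

(** Coordinates of [[x, y], z] are the triple commutators of the coordinates, so
    this element of gamma_3 S has [[s, t], h] as its only non-trivial coordinate,
    and these commutators are the relations of class 2 for the generators s, t. *)
Lemma gamma3_supported_by_pair k x y : S x -> S y ->
  G `<=` generated [set psi x (letter k); psi y (letter k)] ->
  (forall h, G h -> exists z, [/\ S z, psi z (letter k) = h
     & forall j, j != k ->
       [~ [~ psi x (letter j), psi y (letter j)], psi z (letter j)] = 1]) ->
  gamma 3 G `<=` supported k.
Proof.
move=> Sx Sy; set s := psi x _; set t := psi y _ => Gst zP.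
have [[xS Gx] [yS Gy]] := (Sx, Sy).
have Gg := ggs_subgroup e; have [Gs Gt] : G s /\ G t by split; apply: psi_ggs.
have GE : G = generated [set s; t].
  by apply/seteqP; split=> //; apply: generated_sub => // _ [->|->].
have Nst h : G h -> supported k [~ [~ s, t], h].
  move=> /zP[z [Sz zk zj]]; exists [~ [~ x, y], z].
    by apply: mem_commutator => //; apply: mem_commutator.
  have [zS _] := Sz.
  have xyS : stab 1 [~ x, y] := subgroupR (@stab1_subgroup p) xS yS.
  move=> j; rewrite !psiR //; case: eqP => [->|/eqP /zj //].
  by rewrite zk.
rewrite GE; apply: gamma3_generated2_sub; first exact: supported_subgroup.
- by rewrite -GE; apply: supported_normal.
- exact: Nst.
exact: Nst.
Qed.

Lemma exponent0 : E 0%R = 0%R.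
Proof. by rewrite /exponent insubF // ltn_letter eqxx. Qed.

Lemma exponent_neq0 k : E k != 0%R -> k != 0%R.
Proof. by apply: contraNneq => ->; rewrite exponent0. Qed.

Let d0 : d != 0%R := exponent_neq0 Ed.

Lemma d_neqN : d != (- d)%R.
Proof.
rewrite -subr_eq0 opprK -mulr2n -mulr_natr mulf_neq0 //.
by rewrite -(dvdn_pcharf (pchar_Fp p_prime)) gtnNdvd // odd_prime_gt2.
Qed.

Let commute_aX m n : [~ a ^+ m, a ^+ n] = 1.
Proof. by apply/eqP/commgP/commuteX2/commute_refl. Qed.

(** The elements b_0 and b_d commute outside the coordinates 0 and d, since there
    both of them are powers of a. *)
Lemma gamma3_supported_bconj :
  (forall h, G h -> exists z, [/\ S z, psi z (letter d) = h
     & [~ [~ b, a ^+ E (- d)%R], psi z (letter 0%R)] = 1]) ->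
  gamma 3 G `<=` supported d.
Proof.
move=> zP.
apply: (@gamma3_supported_by_pair _ (ggs_bconj e 0%R) (ggs_bconj e d)).
- exact: ggs_bconj_stab.
- exact: ggs_bconj_stab.
- rewrite !ggs_bconj_letter eqxx (negPf d0) subr0.
  set H := generated _; have Hg : is_subgroup H := generated_subgroup _.
  apply: ggs_sub => //; last by apply: mem_generated; right.
  rewrite -(expg_FpK p_prime (ggs_a_order p_prime) Ed).
  by apply: (subgroupX _ Hg); apply: mem_generated; left.
move=> h /zP[z [Sz zd z0]]; exists z; split=> // j jd.
rewrite !ggs_bconj_letter (negPf jd) subr0.
case: eqP => [->|_]; first by rewrite sub0r.
by rewrite commute_aX comm1g.
Qed.

Lemma gamma3_supported_asymmetric :
  E (- d)%R = 0%R -> gamma 3 G `<=` supported d.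
Proof.
move=> Emd; apply: gamma3_supported_bconj => h /(psi_stab_surj d Ed)[z Sz zh].
by exists z; split=> //; rewrite Emd expg0 commg1 comm1g.
Qed.

(** The coordinates d and 0 of b_(-k) and b_(-d) are the powers of a with
    exponents (E (k + d), E k) and (E (2d), E d). As these vectors are
    independent and E d <> 0, products of b_(-k), b_(-d) and b_d realise both a
    and b at d with trivial coordinate 0. *)
Lemma gamma3_supported_nongeometric k : k != 0%R -> k != (- d)%R ->
  (E (k + d) * E d != E (d + d) * E k)%R -> gamma 3 G `<=` supported d.
Proof.
move=> k0 kd; rewrite -subr_eq0; set u := (_ - _)%R => u0.
pose P := [set z | S z /\ psi z (letter 0%R) = 1].
have PS : P `<=` stab 1 by move=> z [[]].
have Pg : is_subgroup P.
  have Sg := stab_in_subgroup e; split.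
  - by split; [case: Sg|rewrite psi1].
  - move=> x y [Sx x0] [Sy y0]; have [[xS _] [yS _]] := (Sx, Sy).
    by split; [exact: subgroupM|rewrite psiM // x0 y0 mulg1].
  move=> x [Sx x0]; have [xS _] := Sx.
  by split; [exact: subgroupV|rewrite psiV // x0 invg1].
have Wg := psi_image_subgroup (letter d) Pg PS.
set W := [set _ | _ in P] in Wg.
suff GW : G `<=` W.
  apply: gamma3_supported_bconj => h /GW[z [Sz z0] zh].
  by exists z; split=> //; rewrite z0 commg1.
have Sg := stab_in_subgroup e.
have bS j : stab 1 (ggs_bconj e j) by have [] := ggs_bconj_stab e j.
have bXS j n : stab 1 (ggs_bconj e j ^+ n).
  exact: (subgroupX _ (@stab1_subgroup p)).
have aX := expg_FpM p_prime (ggs_a_order p_prime).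
have aD := expg_FpD p_prime (ggs_a_order p_prime).
have Wa : W a.
  rewrite -(expg_FpK p_prime (ggs_a_order p_prime) u0); apply: (subgroupX _ Wg).
  exists (ggs_bconj e (- k)%R ^+ E d * ggs_bconj e (- d)%R ^+ (- E k)%R).
    split.
      by apply: (subgroupM Sg); apply: (subgroupX _ Sg); apply: ggs_bconj_stab.
    rewrite psiM // !psiX // !ggs_bconj_letter !(eq_sym 0%R) !oppr_eq0.
    rewrite (negPf k0) (negPf d0) !sub0r !opprK -!aX -aD mulrN.
    by rewrite [X in (_ - X)%R]mulrC subrr.
  rewrite psiM // !psiX // !ggs_bconj_letter !opprK (negPf d_neqN).
  by rewrite -eqr_oppLR eq_sym (negPf kd) -!aX -aD mulrN [(d + k)%R]addrC.
apply: ggs_sub => //.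
(* At the coordinate 0, b_d is a^(E (-d)), which b_(-d)^v cancels. *)
pose v : 'F_p := (- (E (- d) / E d))%R.
suff Wb : W (b * a ^+ (E (d + d) * v)%R).
  rewrite -(mulgK (a ^+ (E (d + d) * v)%R) b); apply: (subgroupM Wg) => //.
  by apply: (subgroupV Wg); apply: (subgroupX _ Wg).
exists (ggs_bconj e d * ggs_bconj e (- d)%R ^+ v).
  split.
    apply: (subgroupM Sg); first exact: ggs_bconj_stab.
    by apply: (subgroupX _ Sg); apply: ggs_bconj_stab.
  rewrite psiM // psiX // !ggs_bconj_letter !(eq_sym 0%R) oppr_eq0 (negPf d0).
  by rewrite !sub0r opprK -aX -aD /v mulrN mulrCA divff // mulr1 subrr.
by rewrite psiM // psiX // !ggs_bconj_letter eqxx (negPf d_neqN) opprK -aX.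
Qed.

Section Geometric.
Local Notation r := (E (d + d) / E d)%R.
Hypothesis Egeom : forall k, k != 0%R -> k != (- d)%R ->
  (E (k + d) * E d = E (d + d) * E k)%R.

Lemma exponent_succ k : k != 0%R -> k != (- d)%R -> E (k + d)%R = (r * E k)%R.
Proof. by move=> k0 kd; rewrite mulrAC -Egeom // mulfK. Qed.

Lemma exponent_geometric m : m.+1 < p ->
  E (m.+1%:R * d)%R = (r ^+ m * E d)%R.
Proof.
have natd0 n : 0 < n -> n < p -> (n%:R * d != 0)%R.
  move=> n0 np; rewrite mulf_neq0 // -(dvdn_pcharf (pchar_Fp p_prime)).
  by rewrite gtnNdvd.
elim: m => [|m IHm] m_ltp; first by rewrite !mul1r.
rewrite -[m.+2%:R%R]natr1 mulrDl mul1r (@exponent_succ (m.+1%:R * d)%R).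
- by rewrite IHm ?exprS ?mulrA // ltnW.
- by rewrite natd0 // ltnW.
rewrite -addr_eq0 -[X in (_ + X)%R]mul1r -mulrDl natr1.
exact: natd0.
Qed.

(** Going once around the circle multiplies E d by r^(p-1) = 1; the indices pass
    through -d just before reaching 0. *)
Lemma exponent_wrap : E (- d)%R != 0%R -> (r * E (- d) = E d)%R.
Proof.
move=> Emd; have p_gt2 := odd_prime_gt2 p_odd p_prime.
have p2_gt0 : 0 < p.-2 by case: p p_gt2 => [|[|[]]].
have pE : p.-2.+2 = p by case: p p_gt2 => [|[|[]]].
have EmdE : E (- d)%R = (r ^+ p.-2 * E d)%R.
  rewrite -exponent_geometric; last by rewrite -[X in _ < X]pE.
  congr E; apply/eqP; rewrite eq_sym -subr_eq0 opprK.
  rewrite -[X in (_ + X)%R]mul1r -mulrDl natr1.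
  by rewrite pE pchar_Fp_0 ?mul0r.
have r0 : r != 0%R.
  apply: contraNneq Emd => r0; rewrite EmdE r0 expr0n -[p.-2 == 0]negbK -lt0n.
  by rewrite p2_gt0 mul0r.
have rp : (r ^+ p)%R = r.
  by rewrite -(natr_Zp r) -natrX -Fp_nat_mod // fermat_little // Fp_nat_mod.
rewrite EmdE mulrA -exprS; have -> : (r ^+ p.-2.+1 = 1)%R.
  by apply: (mulfI r0); rewrite -exprS mulr1 -[RHS]rp pE.
by rewrite mul1r.
Qed.

(** The element x = b_0 b_d^(-r) is trivial outside the coordinates 0 and d, so x
    and its conjugate by a^d have only the coordinate d in common. There the
    product of the second by the first is b^(1 - r), by exponent_wrap, and this
    yields b because r <> 1. *)
Lemma gamma3_supported_geometric : E (- d)%R != 0%R -> r != 1%R ->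
  gamma 3 G `<=` supported d.
Proof.
move=> Emd r1; have Sg := stab_in_subgroup e.
have aX := expg_FpM p_prime (ggs_a_order p_prime).
have aD := expg_FpD p_prime (ggs_a_order p_prime).
pose x := ggs_bconj e 0%R * ggs_bconj e d ^+ (- r)%R.
have Sx : S x.
  apply: (subgroupM Sg); first exact: ggs_bconj_stab.
  by apply: (subgroupX _ Sg); apply: ggs_bconj_stab.
have [xS _] := Sx.
have xE j : psi x (letter j) = (if j == 0%R then b else a ^+ E j)
    * (if j == d then b else a ^+ E (j - d)%R) ^+ (- r)%R.
  have bS k : stab 1 (ggs_bconj e k) by have [] := ggs_bconj_stab e k.
  rewrite psiM // ?psiX ?ggs_bconj_letter ?subr0 //.
  exact: (subgroupX _ (@stab1_subgroup p)).
have x1 j : j != 0%R -> j != d -> psi x (letter j) = 1.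
  move=> j0 jd; rewrite xE (negPf j0) (negPf jd) -aX -aD.
  rewrite -{1}(subrK d j) (@exponent_succ (j - d)%R) ?subr_eq0 //; last first.
    by rewrite subr_eq addNr.
  by rewrite mulrN [X in (_ - X)%R]mulrC subrr.
have yE j : psi (x ^ (a ^+ d)) (letter j) = psi x (letter (j - d)%R).
  exact: psi_conj_aX.
apply: (@gamma3_supported_by_pair _ x (x ^ (a ^+ d))) => //.
- apply: stab_in_conj => //.
  exact: (subgroupX _ (ggs_subgroup e) (@ggs_mem_a p e)).
- rewrite yE subrr !xE !eqxx (negPf d0) eq_sym (negPf d0) sub0r -aX mulrN.
  rewrite (mulrC (E (- d)%R)) exponent_wrap //.
  set H := generated _; have Hg : is_subgroup H := generated_subgroup _.
  have bX := expg_FpD p_prime (ggs_b_order p_prime e).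
  have Hs : H (a ^+ E d * b ^+ (- r)%R) by apply: mem_generated; left.
  have Ht : H (b * a ^+ (- E d)%R) by apply: mem_generated; right.
  have Hb : H b.
    have r1' : (1 - r != 0)%R by rewrite subr_eq0 eq_sym.
    rewrite -(expg_FpK p_prime (ggs_b_order p_prime e) r1').
    apply: (subgroupX _ Hg); have := subgroupM Hg Ht Hs.
    rewrite -mulgA [X in b * X]mulgA -aD addNr mul1g.
    by rewrite bX expg_Fp1.
  apply: ggs_sub => //; rewrite -(expg_FpK p_prime (ggs_a_order p_prime) Ed).
  apply: (subgroupX _ Hg).
  rewrite -[a ^+ _](mulgK (b ^+ (- r)%R)); apply: (subgroupM Hg) => //.
  by apply: (subgroupV Hg); apply: (subgroupX _ Hg).
move=> h /(psi_stab_surj d Ed)[z Sz zh]; exists z; split=> // j jd.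
have [->|/x1 -> //] := eqVneq j 0%R; last by rewrite !comm1g.
(* At 0 the conjugate of x is trivial, since -d is neither 0 nor d. *)
rewrite yE sub0r (x1 (- d)%R) ?oppr_eq0 ?commg1 ?comm1g //.
by rewrite eq_sym d_neqN.
Qed.

End Geometric.
End NonZeroExponent.

(** * The branching subgroup *)

Section NonConstant.
Variable d : 'F_p.
Hypothesis Ed : E d != 0%R.
Hypothesis e_nonconstant : ~ constant_vector e.

Lemma gamma3_supported k : gamma 3 G `<=` supported k.
Proof.
suff Gd : gamma 3 G `<=` supported d.
  by move=> x /Gd/(supported_rotate (k - d)%R); rewrite addrC subrK.
have [Emd|Emd] := eqVneq (E (- d)%R) 0%R.
  exact: gamma3_supported_asymmetric.
have [[j [j0 jd /eqP jE]]|geom] := pselect (exists j, [/\ j != 0%R, j != (- d)%R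
    & (E (j + d) * E d <> E (d + d) * E j)%R]).
  exact: gamma3_supported_nongeometric jE.
have {}geom j : j != 0%R -> j != (- d)%R ->
    (E (j + d) * E d = E (d + d) * E j)%R.
  by move=> j0 jd; apply: contrapT => jE; apply: geom; exists j.
apply: gamma3_supported_geometric => //; apply/eqP => r1; apply: e_nonconstant.
have d0 := exponent_neq0 Ed.
suff Ec j : j != 0%R -> E j = E d.
  move=> u v; have [[i i0 <-] [j j0 <-]] :=
    (exponent_ord p_prime e u, exponent_ord p_prime e v).
  by rewrite !Ec.
(* A progression of ratio 1 is constant along the multiples m d of d, that is,
   along all the non-zero indices. *)
move=> j0; pose m : 'F_p := (j / d)%R.
have m0 : (0 < m)%N.
  rewrite lt0n; apply: contraNneq (mulf_neq0 j0 (invr_neq0 d0)) => /eqP.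
  by rewrite -(inj_eq val_inj).
have mp : m < p by rewrite -[X in (_ < X)%N](Fp_cast p_prime) ltn_ord.
have := @exponent_geometric d Ed geom m.-1.
rewrite prednK // r1 expr1n mul1r natr_Zp divfK //.
exact.
Qed.

Lemma gamma3_direct_power : direct_power (gamma 3 G) `<=` psi @` gamma 3 S.
Proof.
move=> h Gh; have Tg := gamma3_stab_subgroup.
suff [x Tx xE] : exists2 x, gamma 3 S x
    & forall k, psi x (letter k) = if k \in enum 'F_p then h (letter k) else 1.
  exists x => //; apply/funext => i; have [k <-] := letterP p_prime i.
  by rewrite xE mem_enum.
elim: (enum _) (enum_uniq 'F_p) => [_|k s IHs /= /andP[ks /IHs[x Tx xE]]].
  by exists 1 => [|k]; [case: Tg|rewrite psi1].
have [y Ty yE] := gamma3_supported k (Gh (letter k)).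
exists (x * y) => [|j]; first exact: (subgroupM Tg).
have [[xS _] [yS _]] := (gamma3_stab Tx, gamma3_stab Ty).
rewrite psiM // xE yE in_cons; case: eqP => [->|_]; last by rewrite mulg1.
by rewrite (negPf ks) mul1g.
Qed.

Lemma psi_gamma3_stab : psi @` gamma 3 S = direct_power (gamma 3 G).
Proof.
apply/seteqP; split; last exact: gamma3_direct_power.
move=> _ [x Tx <-] i.
apply: (gamma_rec_map (n := 2) (f := fun x => psi x i)) Tx.
- exact: stab_in_subgroup.
- exact: ggs_subgroup.
- by move=> y z [yS _] [zS _]; rewrite psiM.
by move=> y [_ Gy]; apply: psi_ggs.
Qed.

Lemma gamma3_stab_sub_gamma3 : gamma 3 S `<=` gamma 3 G.
Proof.
move=> x; apply: (gamma_rec_map (n := 2) (f := id)) => //.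
- exact: stab_in_subgroup.
- exact: ggs_subgroup.
by move=> y [].
Qed.

(** G acts on the first level through powers of a, hence commutatively. *)
Lemma gamma2_sub_stab : gamma 2 G `<=` S.
Proof.
have Gg := ggs_subgroup e; have Sg := stab_in_subgroup e.
apply: commutator_generated_sub => //.
  by move=> x h Sx Gh; apply: stab_in_conj.
have Sb : S b by split; [apply: ggs_b_stab|apply: ggs_mem_b].
have Sba : S [~ b, a].
  rewrite commgEl; apply: (subgroupM Sg); first exact: (subgroupV Sg).
  exact: (stab_in_conj Sb (@ggs_mem_a p e)).
move=> _ _ [->|->] [->|->]; rewrite ?commgg //; try by case: Sg.
by rewrite -invgR; apply: (subgroupV Sg).
Qed.

Lemma gamma3_sub_stab : gamma 3 G `<=` S.
Proof.
have Gg := ggs_subgroup e; have Sg := stab_in_subgroup e.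
apply: commutator_sub => // x y /gamma2_sub_stab Sx Gy.
rewrite commgEl; apply: (subgroupM Sg); first exact: (subgroupV Sg).
exact: stab_in_conj.
Qed.

Lemma ggs_a_nstab k : k != 0%R -> ~ stab 1 (a ^+ k).
Proof.
move=> k0 /(_ [:: letter 0%R] erefl).
rewrite ggs_aX_letter natr_Zp add0r => /eqP.
rewrite eqseq_cons => /andP[/eqP/letter_inj/eqP].
by rewrite (negPf k0).
Qed.

(** If gamma_3 G were trivial, G' would be central, so b would commute with its
    conjugates; reading this at the coordinate d makes b commute with a. Then b
    is its own conjugate by a^d, and comparing coordinates at d gives
    b = a^(E d), although b fixes the first level and a^(E d) moves it. *)
Lemma gamma3_neq1 : gamma 3 G <> [set 1].
Proof.
move=> K1; have Gg := ggs_subgroup e; have d0 := exponent_neq0 Ed.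
have [Ga Gb] : G a /\ G b by split; [apply: ggs_mem_a|apply: ggs_mem_b].
have Gad : G (a ^+ d) by exact: (subgroupX _ Gg).
have bb : [~ ggs_bconj e 0%R, ggs_bconj e d] = 1.
  have : gamma 3 G [~ [~ b, a ^+ d], b].
    by apply: mem_commutator => //; apply: mem_commutator.
  rewrite K1 => /= c1; rewrite /ggs_bconj expg0 conjg1 conjg_mulR.
  apply/eqP/commgP; apply: commuteM; first exact: commute_refl.
  exact/commute_sym/commgP/eqP.
have := congr1 (fun g => psi g (letter d)) bb; rewrite psi1 psiR; last 2 first.
- by case: (ggs_bconj_stab e 0%R).
- by case: (ggs_bconj_stab e d).
rewrite !ggs_bconj_letter eqxx (negPf d0) subr0 => /eqP/commgP ab.
have ba : commute b a.
  rewrite -(expg_FpK p_prime (ggs_a_order p_prime) Ed).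
  by apply/commuteX/commute_sym.
have bad : b ^ (a ^+ d) = b by apply/conjg_fixP/commgP/commuteX.
have := congr1 (fun g => psi g (letter d)) bad.
rewrite -[b ^ _]/(ggs_bconj e d) ggs_bconj_letter eqxx ggs_b_letter.
rewrite (negPf d0) => bE.
by apply: (ggs_a_nstab Ed); rewrite -bE; apply: ggs_b_stab.
Qed.

Lemma ggs_regular_branch : regular_branch G (gamma 3 G).
Proof.
have Gg := ggs_subgroup e; split; last first.
  exact: finite_index_gamma3 (prime_gt0 p_prime) (ggs_a_order p_prime)
    (ggs_b_order p_prime e).
split=> //.
- exact: ggs_self_similar.
- exact: ggs_transitive Ed.
- exact: (gamma_rec_subgroup 2 Gg).
- exact: gamma3_sub_stab.
- exact: gamma3_neq1.
by move=> h /gamma3_direct_power[x /gamma3_stab_sub_gamma3 Gx <-]; exists x.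
Qed.

End NonConstant.
End Branching.

Theorem lemma3p2 (p : nat) (p_prime : prime p) (p_odd : odd p)
    (e : 'rV['F_p]_p.-1) (e_neq0 : e <> 0%R)
    (e_nonconstant : ~ constant_vector e) :
  let G := ggs_group e in
  [/\ psi @` gamma 3 (stab_in G 1) = direct_power (gamma 3 G),
      direct_power (gamma 3 G) `<=` psi @` gamma 3 G
    & regular_branch G (gamma 3 G)].
Proof.
have [d Ed] : exists d, exponent p_prime e d != 0%R.
  apply: contrapT => E0; apply: e_neq0; apply/rowP => u; rewrite mxE.
  have [k _ <-] := exponent_ord p_prime e u.
  by apply: contrapT => /eqP Ek; apply: E0; exists k.
split.
- exact: psi_gamma3_stab Ed e_nonconstant.
- move=> h /(gamma3_direct_power p_odd Ed e_nonconstant)[x Tx <-].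
  by exists x => //; apply: gamma3_stab_sub_gamma3.
exact: ggs_regular_branch Ed e_nonconstant.
Qed.
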